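(* Let $F\subseteq bcn(S)$ be compact in the topology of pointwise convergence on $S$ and bounded with respect to the supremum norm, and let $\delta>0$ and $\epsilon\in(0,1)$ be given. Then there exists a subtree $T$ of $S$ with the following property: for every chain $\beta=(s_i)_{i=1}^\infty$ of $T$, every $f\in F$, every $n\in\mathbb{N}$ and every nonempty $I\subseteq\{1,\ldots,n\}$ with $\min_{i\in I}f(s_i)>\delta$, there exists $g\in F$ such that (i) $\min_{i\in I}g(s_i)>(1-\epsilon)\delta$; and (ii) $\sum_{i\le n,\, i\notin I}|g(s_i)|<\epsilon\delta$.
   Context: $S=\bigcup_{n=0}^\infty\{0,1\}^n$ is the dyadic tree of all finite sequences in $\{0,1\}$ (including the empty one), partially ordered by the initial segment relation $\le$. A subtree of $S$ is a subset $T\subseteq S$, with the induced order, which has a single minimal element and in which every element has exactly two immediate successors (i.e. for each $t\in T$ there are exactly two minimal elements of $\{t'\in T: t<t'\}$); thus $T$ is order isomorphic to $S$. A chain of a tree $T$ is an infinite linearly ordered subset of $T$. A chain is written $\beta=(s_i)_{i=1}^\infty$ with its elements enumerated increasingly, $s_1<s_2<\cdots$. $bcn(S)$ denotes the set of all bounded functions $f:S\to\mathbb{R}$ such that for every chain $\beta$ of $S$ the sequence $(f(s))_{s\in\beta}$ converges to zero; it is endowed with the topology of pointwise convergence (the relative product topology of $\mathbb{R}^S$). *)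

(* Defs.v *)
From HB Require Import structures.
From mathcomp Require Import all_boot all_order all_algebra.
From mathcomp Require Import all_classical all_reals all_analysis.

Set Implicit Arguments.
Unset Strict Implicit.
Unset Printing Implicit Defensive.

Import Order.TTheory GRing.Theory Num.Theory.
Import numFieldNormedType.Exports.

Local Open Scope classical_set_scope.
Local Open Scope ring_scope.

Definition dyadic : Type := seq bool.

Definition tle (s t : dyadic) : bool := seq.prefix s t.

Definition tlt (s t : dyadic) : bool := (s != t) && tle s t.

Definition minimal_elements (A : set dyadic) : set dyadic :=
  [set m | A m /\ forall a, A a -> tle a m -> a = m].

Definition immediate_successors (T : set dyadic) (t : dyadic) : set dyadic :=
  minimal_elements [set t' | T t' /\ tlt t t'].

Definition is_subtree (T : set dyadic) : Prop :=
  (exists m, minimal_elements T = [set m]) /\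
  (forall t, T t -> exists t1 t2, t1 != t2 /\
     immediate_successors T t = [set t1; t2]).

Definition is_chain (T beta : set dyadic) : Prop :=
  [/\ beta `<=` T, infinite_set beta &
      forall s t, beta s -> beta t -> tle s t \/ tle t s].

(* Indices start at 0: the element s_i of the usual 1-based enumeration
   s_1 < s_2 < ... of a chain is [s i.-1]. *)
Definition enumerates (beta : set dyadic) (s : nat -> dyadic) : Prop :=
  range s = beta /\ forall i j : nat, (i < j)%N -> tlt (s i) (s j).

Definition bcn (R : realType) : set (dyadic -> R) :=
  [set f | bounded_fun f /\
     forall (beta : set dyadic) (s : nat -> dyadic),
       is_chain setT beta -> enumerates beta s ->
       (fun i => f (s i)) @ \oo --> (0 : R)].
Arguments bcn R : clear implicits.

(* Compactness in bcn for the relative topology is compactness in the whole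
   product R^S; the [ptws] annotation selects the product topology. *)
Definition pointwise_compact (R : realType) (F : set (dyadic -> R)) : Prop :=
  compact (F : set {ptws dyadic -> R}).

Definition sup_norm_bounded (R : realType) (F : set (dyadic -> R)) : Prop :=
  exists M : R, forall f, F f -> forall s, `|f s| <= M.

(* Main.v *)
Require Import Defs.
From HB Require Import structures.
From mathcomp Require Import all_boot all_order all_algebra.
From mathcomp Require Import all_classical all_reals all_analysis.
From mathcomp Require Import zify ring lra.

Set Implicit Arguments.
Unset Strict Implicit.
Unset Printing Implicit Defensive.

Import Order.TTheory GRing.Theory Num.Theory.
Import numFieldNormedType.Exports.

Local Open Scope classical_set_scope.
Local Open Scope ring_scope.

(** Given a function [f] and a set [I] of positions on a chain, the values at
    the positions outside [I] are killed one by one.  Killing the value at [m]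
    may fail only if the later nodes of [I] contain a finite chain [A]
    obstructing [m]: some [f] in the current piece of [F] is [>= delta] on [A],
    but every such [f] has [|f m| >= theta].  Pieces are cells of a finite
    partition of [F] according to the approximate values on the nodes below
    [m], so that moving inside a piece hardly changes the earlier values.

    A Nash-Williams dichotomy for the dyadic tree (combinatorial forcing plus
    fusion) gives a subtree in which, for each piece and each [m], either no
    finite chain above [m] obstructs [m], or every infinite chain above [m] has
    an initial segment obstructing [m].  The second case cannot hold for all
    members of an infinite chain [m_0 < m_1 < ...]: the longest of the initial
    segments obstructing [m_0, ..., m_k] obstructs all of them, which gives
    [f_k] in [F] with [|f_k m_j| >= theta] for [j <= k], and a cluster point of
    the [f_k] would not tend to [0] along the chain.  A second fusion therefore
    reaches a subtree without obstructions. *)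

(** * The initial segment order on the dyadic tree *)

Lemma tle_refl (s : dyadic) : tle s s.
Proof. exact: prefix_refl. Qed.

Lemma tle_trans (t s u : dyadic) : tle s t -> tle t u -> tle s u.
Proof. exact: prefix_trans. Qed.

Lemma tle_anti (s t : dyadic) : tle s t -> tle t s -> s = t.
Proof.
rewrite /tle => /prefixP[p ->] /prefixP[q] /(congr1 size).
by case: p => [|b p]; rewrite ?cats0 // !size_cat /=; lia.
Qed.

Lemma tltW (s t : dyadic) : tlt s t -> tle s t.
Proof. by case/andP. Qed.

Lemma tlt_irr (s : dyadic) : tlt s s = false.
Proof. by rewrite /tlt eqxx. Qed.

Lemma tle_tlt_trans (t s u : dyadic) : tle s t -> tlt t u -> tlt s u.
Proof.
move=> st /andP[tu tu']; apply/andP; split; last exact: tle_trans tu'.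
by apply: contra tu => /eqP su; subst u; rewrite (tle_anti tu' st).
Qed.

Lemma tlt_tle_trans (t s u : dyadic) : tlt s t -> tle t u -> tlt s u.
Proof.
move=> /andP[st st'] tu; apply/andP; split; last exact: tle_trans tu.
by apply: contra st => /eqP su; subst u; rewrite (tle_anti tu st').
Qed.

Lemma tlt_trans (t s u : dyadic) : tlt s t -> tlt t u -> tlt s u.
Proof. by move=> /tltW; exact: tle_tlt_trans. Qed.

Lemma tle_total_below (s t u : dyadic) :
  tle s u -> tle t u -> tle s t || tle t s.
Proof.
rewrite /tle; elim: u s t => [|c u IH] [|a s] [|b t] //=.
move=> /andP[/eqP -> su] /andP[/eqP -> tu].
by rewrite !eqxx; exact: IH.
Qed.

Lemma tlt_rcons (s : dyadic) (b : bool) : tlt s (rcons s b).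
Proof.
rewrite /tlt /tle prefix_rcons andbT.
by apply/eqP => /(congr1 size); rewrite size_rcons; lia.
Qed.

Lemma tltP (s t : dyadic) : tlt s t -> exists b, tle (rcons s b) t.
Proof.
case/andP => + /prefixP[q tE]; subst t.
case: q => [|b q _]; first by rewrite cats0 eqxx.
by exists b; rewrite /tle -cat_rcons prefix_prefix.
Qed.

(** * Incomparability and branching sets *)

Definition incomparable (s t : dyadic) : bool := ~~ tle s t && ~~ tle t s.

Lemma incomparable_rcons (s : dyadic) (b : bool) :
  incomparable (rcons s b) (rcons s (~~ b)).
Proof.
rewrite /incomparable /tle; elim: s => [|a s IH] /=; last by rewrite eqxx.
by case: b.
Qed.

Lemma incomparable_fork (s t : dyadic) : incomparable s t ->
  exists r b, tle (rcons r b) s /\ tle (rcons r (~~ b)) t.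
Proof.
rewrite /incomparable /tle.
elim: s t => [|a s IH] [|b t] //=.
have [->|neq] := eqVneq b a.
  rewrite /= => /IH[r [c [rs rt]]].
  by exists (a :: r), c; rewrite /= eqxx.
move=> _; exists [::], a; rewrite /= eqxx; split; rewrite ?prefix0s //.
by case: a b neq => [] [].
Qed.

Lemma incomparable_tlt (r s t : dyadic) :
  tle r s -> tle r t -> incomparable s t -> tlt r s /\ tlt r t.
Proof.
rewrite /incomparable /tlt => rs rt /andP[st ts]; rewrite rs rt !andbT.
split; first by apply: contraNneq st => <-.
by apply: contraNneq ts => <-.
Qed.

(* Closed under arbitrary unions and under passing to a cone, unlike subtrees;
   every such set contains a subtree. *)
Definition branching (U : set dyadic) : Prop :=
  U !=set0 /\ forall t, U t ->
    exists u v, [/\ U u, U v, tle t u, tle t v & incomparable u v].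

Definition above (a : seq dyadic) : set dyadic :=
  [set t | all (fun x => tlt x t) a].

(* A finite chain is listed from its largest element down. *)
Definition finite_chain (a : seq dyadic) : bool :=
  pairwise (fun x y => tlt y x) a.

Lemma above_sub (a b : seq dyadic) : {subset a <= b} -> above b `<=` above a.
Proof. by move=> ab t /allP tb; apply/allP => x /ab /tb. Qed.

Lemma branchingT : branching setT.
Proof.
split=> [|t _]; first by exists [::].
exists (rcons t true), (rcons t false).
by split=> //; rewrite ?tltW ?tlt_rcons //; exact: (incomparable_rcons t true).
Qed.

Lemma branching_cone (U : set dyadic) (t : dyadic) :
  branching U -> U t -> branching (U `&` above [:: t]).
Proof.
move=> [_ Ub] Ut; split.
  have [u [v [Uu _ tu tv uv]]] := Ub _ Ut.
  have [tu' _] := incomparable_tlt tu tv uv.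
  by exists u; split=> //; rewrite /above /= tu'.
move=> s [Us /= /andP[ts _]].
have [u [v [Uu Uv su sv uv]]] := Ub _ Us.
exists u, v; split=> //.
  by split=> //; rewrite /above /= (tlt_tle_trans ts su).
by split=> //; rewrite /above /= (tlt_tle_trans ts sv).
Qed.

(** Incomparability survives moving both nodes up, because the initial segments of one node are
    linearly ordered. Hence an incomparable pair in [U] can be pushed into [A]. *)
Lemma branching_dense (U A : set dyadic) :
  branching U -> (forall u, U u -> exists v, [/\ U v, A v & tlt u v]) ->
  branching (U `&` A).
Proof.
move=> [[u0 Uu0] Ub] dense; split.
  by have [v [Uv Av _]] := dense _ Uu0; exists v.
move=> t [Ut _]; have [u [v [Uu Uv tu tv uv]]] := Ub _ Ut.
have [u' [Uu' Au' /tltW uu']] := dense _ Uu.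
have [v' [Uv' Av' /tltW vv']] := dense _ Uv.
exists u', v'; split=> //; [exact: tle_trans uu'|exact: tle_trans vv'|].
move: uv; rewrite /incomparable => /andP[uv vu].
apply/andP; split; apply/negP => h.
  have /orP[] := tle_total_below (tle_trans uu' h) vv'; exact/negP.
have /orP[] := tle_total_below uu' (tle_trans vv' h); exact/negP.
Qed.

(** * Copies of the dyadic tree inside itself *)

Section Embedding.
Variable e : dyadic -> dyadic.
Hypothesis e_lt : forall s t, tlt s t -> tlt (e s) (e t).
Hypothesis e_fork : forall s b, incomparable (e (rcons s b)) (e (rcons s (~~ b))).

(** The order is reflected because incomparable nodes separate at a fork [r]: by [e_fork] the images
    of its two successors are incomparable, so they cannot both lie below [e t]. *)
Lemma embedding_tle (s t : dyadic) : tle (e s) (e t) = tle s t.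
Proof.
have e_le x y : tle x y -> tle (e x) (e y).
  have [->|xy] := eqVneq x y; first by rewrite !tle_refl.
  by move=> xy'; apply/tltW/e_lt; rewrite /tlt xy.
apply/idP/idP => [est|]; last exact: e_le.
apply: contraT => nst; have [ts|nts] := boolP (tle t s).
  have: tlt t s by rewrite /tlt ts andbT; apply: contraNneq nst => ->; exact: tle_refl.
  by move/e_lt => h; have := tle_tlt_trans est h; rewrite tlt_irr.
have /incomparable_fork[r [b [/e_le rs /e_le rt]]] : incomparable s t by rewrite /incomparable nst.
have /orP := tle_total_below (tle_trans rs est) rt.
have /andP[/negP h1 /negP h2] := e_fork r b.
by case.
Qed.

Lemma embedding_inj : injective e.
Proof. by move=> s t st; apply: tle_anti; rewrite -embedding_tle st tle_refl. Qed.

Lemma embedding_tlt (s t : dyadic) : tlt (e s) (e t) = tlt s t.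
Proof. by rewrite /tlt embedding_tle (inj_eq embedding_inj). Qed.

Lemma embedding_branching : branching (range e).
Proof.
split=> [|_ [s _ <-]]; first by exists (e [::]), [::].
exists (e (rcons s true)), (e (rcons s false)).
split; try exact: imageT; rewrite ?embedding_tle ?tltW ?tlt_rcons //.
Qed.

Lemma embedding_subtree : is_subtree (range e).
Proof.
split.
  exists (e [::]); apply/seteqP; split=> [m [[s _ <-]] /= h|_ /= ->].
    by rewrite (h _ (imageT e [::])) ?embedding_tle //; exact: prefix0s.
  split=> [|_ [s _ <-]]; first exact: imageT.
  by rewrite embedding_tle /tle prefixs0 => /eqP ->.
move=> _ [s _ <-]; exists (e (rcons s true)), (e (rcons s false)); split.
  by rewrite (inj_eq embedding_inj) eqseq_rcons andbF.
have S b : [set t' | range e t' /\ tlt (e s) t'] (e (rcons s b)).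
  by split; [exact: imageT|rewrite embedding_tlt tlt_rcons].
apply/seteqP; split=> [_ [[[t _ <-]] st h]|].
  move: st; rewrite embedding_tlt => /tltP[b bt].
  have <- := h _ (S b) _; last by rewrite embedding_tle.
  by case: b {bt}; [left|right].
move=> x xE; have [b ->{x xE}] : exists b, x = e (rcons s b).
  by case: xE => ->; [exists true|exists false].
split=> // _ [[t _ <-]]; rewrite embedding_tlt embedding_tle => /tltP[c ct] tb.
have := tle_trans ct tb.
have : size (rcons s c) = size (rcons s b) by rewrite !size_rcons.
rewrite /tle prefixE => -> /[!take_size] /eqP bc; subst.
by congr e; apply: tle_anti => //; rewrite bc.
Qed.

End Embedding.

(** * Fusion of branching sets *)

Fixpoint sublists (p : seq dyadic) : seq (seq dyadic) :=
  if p is x :: q then sublists q ++ [seq x :: a | a <- sublists q]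
  else [:: [::]].

Lemma sublists_subseq (p a : seq dyadic) : a \in sublists p -> seq.subseq a p.
Proof.
elim: p a => [|x p IH] a /=; first by rewrite inE.
rewrite mem_cat => /orP[/IH ap|/mapP[b /IH bp ->]]; last by rewrite /= eqxx.
exact: subseq_trans (subseq_cons _ _).
Qed.

(** Finite chains are listed in strictly decreasing order, so containment as sets forces containment
    as lists. *)
Lemma mem_sublists (p a : seq dyadic) : finite_chain p -> finite_chain a ->
  {subset a <= p} -> a \in sublists p.
Proof.
elim: p a => [|x p IH] [|y a] //= pc.
- by move=> _ h; have := h y; rewrite !inE eqxx => /(_ isT).
- by move=> _ _; rewrite mem_cat IH //; case/andP: pc.
move: pc => /andP[/allP xp pc] /andP[/allP ya ac] sub.
have [yx|yx] := eqVneq y x.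
  subst y; rewrite mem_cat; apply/orP; right; apply/map_f/IH => // z za.
  have := sub z; rewrite !inE za orbT => /(_ isT) /predU1P[zx|//].
  by have := ya z za; rewrite zx tlt_irr.
have yp : y \in p.
  by have := sub y; rewrite !inE eqxx (negbTE yx) => /(_ isT).
rewrite mem_cat IH //; first by apply/andP; split=> //; exact/allP.
move=> z; rewrite inE => /predU1P[->//|za].
have := sub z; rewrite !inE za orbT => /(_ isT) /predU1P[zx|//].
by have := tlt_trans (ya z za) (xp y yp); rewrite zx tlt_irr.
Qed.

(** Requirements that pass to smaller sets can be met one after another: the earlier ones
    persist. *)
Lemma shrink_all (I : eqType) (L : seq I) (Q : I -> set dyadic -> Prop)
    (U : set dyadic) :
  (forall i V W, V `<=` W -> Q i W -> Q i V) ->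
  (forall i V, i \in L -> V `<=` U -> branching V ->
     exists W, [/\ W `<=` V, branching W & Q i W]) ->
  branching U ->
  exists W, [/\ W `<=` U, branching W & forall i, i \in L -> Q i W].
Proof.
move=> Qmono; elim: L => [|i L IH] dense Ub; first by exists U; split.
have [j V jL|//|W [WU Wb QW]] := IH.
  by apply: dense; rewrite inE jL orbT.
have [W' [W'W W'b QW']] := dense i W (mem_head _ _) WU Wb.
exists W'; split=> //; first exact: subset_trans WU.
by move=> j /predU1P[->//|/QW]; exact: Qmono.
Qed.

Section Fusion.
Variables (P : seq dyadic -> set dyadic -> Prop) (U : set dyadic).
Hypothesis P_mono : forall a V W, V `<=` W -> P a W -> P a V.
Hypothesis P_dense : forall a V, finite_chain a -> [set` a] `<=` U ->
  V `<=` U `&` above a -> branching V ->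
  exists W, [/\ W `<=` V, branching W & P a W].

(* A stage of the fusion at a node of the tree under construction: the nodes
   chosen so far on the path to it, and the reservoir for its successors. *)
Let stage (pV : seq dyadic * set dyadic) : Prop :=
  let: (p, V) := pV in
  [/\ finite_chain p, [set` p] `<=` U, V `<=` U `&` above p, branching V &
      forall a, a \in sublists p -> P a V].

Let stage_extend (p : seq dyadic) (V : set dyadic) (x : dyadic) :
  stage (p, V) -> V x ->
  exists W, [/\ W `<=` V, W `<=` above [:: x] & stage (x :: p, W)].
Proof.
move=> [pc pU VU Vb PV] Vx.
have xpc : finite_chain (x :: p) by have [_ xp] := VU _ Vx; apply/andP.
have xpU : [set` x :: p] `<=` U.
  by move=> y /predU1P[->|/pU//]; have [] := VU _ Vx.
pose V' := V `&` above [:: x].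
have V'U : V' `<=` U `&` above (x :: p).
  move=> y [Vy /= /andP[xy _]]; have [Uy yp] := VU _ Vy; split=> //.
  exact/andP.
have [||W [WV' Wb PW]] := @shrink_all _ (sublists (x :: p)) P V' P_mono.
- move=> a W ax WV' Wb; have ax' := sublists_subseq ax.
  apply: P_dense => //; first exact: subseq_pairwise ax' xpc.
    by move=> y ya; apply: xpU; exact: (mem_subseq ax').
  move=> y /WV' /V'U [Uy yp]; split=> //.
  exact: (above_sub (mem_subseq ax')) yp.
- exact: branching_cone.
exists W; split; [by move=> y /WV' []|by move=> y /WV' []|].
by split=> //; exact: subset_trans WV' V'U.
Qed.

Let next_rel (pV : seq dyadic * set dyadic)
    (qW : bool -> seq dyadic * set dyadic) : Prop :=
  exists x : bool -> dyadic, incomparable (x true) (x false) /\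
    forall b, [/\ stage (qW b), pV.2 (x b), (qW b).1 = x b :: pV.1,
                  (qW b).2 `<=` pV.2 & (qW b).2 `<=` above [:: x b]].

Let next_ex pV : exists qW, stage pV -> next_rel pV qW.
Proof.
case: pV => p V; have [st|nst] := pselect (stage (p, V)); last first.
  (* A dummy value off the stages, so that choice yields a total [nxt]. *)
  by exists (fun=> (p, V)) => /nst.
have [_ _ _ [[t Vt] Vb] _] := st.
have [u [v [Vu Vv _ _ uv]]] := Vb t Vt.
pose x (b : bool) := if b then u else v.
have /choice[W HW] : forall b, exists W,
    [/\ W `<=` V, W `<=` above [:: x b] & stage (x b :: p, W)].
  by move=> b; apply: stage_extend => //; case: b.
exists (fun b => (x b :: p, W b)) => _; exists x; split=> // b.
by have [h1 h2 h3] := HW b; split=> //; rewrite /x; case: (b).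
Qed.

(** A nonempty finite chain of [T] is a sublist of the path to its largest node. Its requirement was
    met in the reservoir left when that node was added, and all nodes of [T] above it come from this
    reservoir. *)
Lemma fusion : branching U -> exists T, [/\ T `<=` U, is_subtree T, branching T &
  forall a, finite_chain a -> [set` a] `<=` T -> P a (T `&` above a)].
Proof.
move=> Ub.
have [U1 [U1U U1b PU1]] : exists W, [/\ W `<=` U, branching W & P [::] W].
  by apply: P_dense => // x Ux; split.
have st0 : stage ([::], U1).
  by split=> // [t /U1U|a] //; rewrite inE => /eqP ->.
have /choice[nxt nxtP] := next_ex.
(* Only one of the two incomparable candidates is kept as the root, so that [T] has a single minimal
   element. *)
pose run0 := nxt ([::], U1) true.
have run0_stage : stage run0 by have [x [_ /(_ true)[]]] := nxtP _ st0.
pose run (s : dyadic) := foldl (fun pV b => nxt pV b) run0 s.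
pose e s := head [::] (run s).1.
have run_stage s : stage (run s).
  elim/last_ind: s => [//|s b IH]; rewrite /run foldl_rcons -/(run s).
  by have [x [_ /(_ b)[]]] := nxtP _ IH.
have runS s : incomparable (e (rcons s true)) (e (rcons s false)) /\
    forall b, [/\ (run s).2 (e (rcons s b)),
      (run (rcons s b)).1 = e (rcons s b) :: (run s).1,
      (run (rcons s b)).2 `<=` (run s).2 &
      (run (rcons s b)).2 `<=` above [:: e (rcons s b)]].
  have [x [x_inc xP]] := nxtP _ (run_stage s).
  have eE b : e (rcons s b) = x b.
    by rewrite /e /run foldl_rcons -/(run s); have [_ _ ->] := xP b.
  rewrite !eE; split=> // b; have [_ h1 h2 h3 h4] := xP b.
  by rewrite eE /run foldl_rcons.
have e0 : U1 (e [::]) /\ run0.1 = [:: e [::]] /\ run0.2 `<=` U1 /\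
    run0.2 `<=` above [:: e [::]].
  have [x [_ /(_ true)[]]] := nxtP _ st0.
  by rewrite /e /= -/run0 => _ Vx rE sub1 sub2; rewrite rE /=.
have run_above s : (run s).2 `<=` above [:: e s].
  elim/last_ind: s => [|s b _]; first by have [_ [_ []]] := e0.
  by have [_ /(_ b)[]] := runS s.
have e_run1 s : e s \in (run s).1.
  case/lastP: s => [|s b]; first by have [_ [-> _]] := e0; rewrite mem_head.
  by have [_ /(_ b)[_ -> _ _]] := runS s; rewrite mem_head.
have run1_mono s t : {subset (run s).1 <= (run (s ++ t)).1}.
  elim/last_ind: t => [|t b IH] x xs; first by rewrite cats0.
  have [_ /(_ b)[_ E _ _]] := runS (s ++ t).
  by rewrite -rcons_cat E inE IH ?orbT.
have run2_mono s t : (run (s ++ t)).2 `<=` (run s).2.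
  elim/last_ind: t => [|t b IH]; first by rewrite cats0.
  have [_ /(_ b)[_ _ E _]] := runS (s ++ t).
  by rewrite -rcons_cat; exact: subset_trans IH.
have run_lt s t : tlt s t -> (run s).2 (e t).
  move=> /andP[+ /prefixP[q tE]]; subst t.
  case/lastP: q => [|q b _]; first by rewrite cats0 eqxx.
  by rewrite -rcons_cat; have [_ /(_ b)[h _ _ _]] := runS (s ++ q); exact: run2_mono h.
have e_lt s t : tlt s t -> tlt (e s) (e t).
  by move=> /run_lt /run_above /andP[].
have e_fork s b : incomparable (e (rcons s b)) (e (rcons s (~~ b))).
  have [h _] := runS s; case: b => //=.
  by move: h; rewrite /incomparable andbC.
have run2U1 s : (run s).2 `<=` U1.
  by apply: subset_trans (run2_mono [::] s) _; have [_ [_ []]] := e0.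
have eU1 s : U1 (e s).
  have [->|s_neq0] := eqVneq s [::]; first by have [] := e0.
  by apply/(run2U1 [::])/run_lt; rewrite /tlt eq_sym s_neq0 /tle prefix0s.
exists (range e); split.
- by move=> _ [s _ <-]; apply: U1U.
- exact: embedding_subtree.
- exact: embedding_branching.
(* The empty chain was settled by [U1], before the root was chosen. *)
case=> [_ _|x a ac aT].
  by apply: P_mono (PU1) => _ [[s _ <-] _].
have [s _ es] : range e x by apply: aT; rewrite /= mem_head.
have [run_c _ _ _ run_P] : stage ((run s).1, (run s).2).
  by rewrite -surjective_pairing.
have /run_P : x :: a \in sublists (run s).1.
  apply: mem_sublists => // y ya.
  have [r _ er] : range e y by apply: aT.
  have /prefixP[q sE] : tle r s.
    rewrite -(embedding_tle e_lt e_fork) er es.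
    move: ya; rewrite inE => /predU1P[->|ya]; first exact: tle_refl.
    by apply: tltW; move: ac => /andP[/allP/(_ y ya)].
  by rewrite sE; apply: run1_mono; rewrite -er.
apply: P_mono => _ [[t _ <-]] /andP[+ _]; rewrite -es => st.
by apply: run_lt; rewrite -(embedding_tlt e_lt e_fork).
Qed.

End Fusion.

(** * Bars and the Nash-Williams dichotomy *)

Definition barred (B : seq dyadic -> Prop) (a : seq dyadic) (U : set dyadic) :
    Prop :=
  forall c : nat -> dyadic, (forall i, tlt (c i) (c i.+1)) ->
    (forall i, U (c i)) -> exists n, B (rev (mkseq c n) ++ a).

Lemma barred_sub (B : seq dyadic -> Prop) (a : seq dyadic) (U V : set dyadic) :
  V `<=` U -> barred B a U -> barred B a V.
Proof. by move=> VU Ubar c c_incr cV; apply: Ubar => // i; apply: VU. Qed.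

Lemma increasing_tlt (c : nat -> dyadic) :
  (forall i, tlt (c i) (c i.+1)) -> forall i j, (i < j)%N -> tlt (c i) (c j).
Proof.
move=> c_incr i j; elim: j => // j IH; rewrite ltnS leq_eqVlt.
by case/predU1P => [->//|/IH ij]; exact: tlt_trans ij _.
Qed.

Lemma barred_cons (B : seq dyadic -> Prop) (a : seq dyadic) (U V : set dyadic) :
  V `<=` U -> (forall t, V t -> barred B (t :: a) (U `&` above (t :: a))) ->
  V `<=` above a -> barred B a V.
Proof.
move=> VU Vbar Va c c_incr cV.
have [|i|n Bn] := Vbar _ (cV 0%N) (fun i => c i.+1).
- by move=> i; exact: c_incr.
- split; first exact: VU.
  apply/andP; split; first exact: (increasing_tlt c_incr).
  exact: Va.
exists n.+1; move: Bn.
by rewrite /mkseq /= -[1%N]addn0 iotaDl -map_comp rev_cons cat_rcons.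
Qed.

(* Combinatorial forcing: [U] accepts [a] when [barred B a U]. *)
Lemma nash_williams_tree (B : seq dyadic -> Prop) (U : set dyadic) :
  branching U -> exists V, [/\ V `<=` U, branching V &
    (forall a, finite_chain a -> [set` a] `<=` V -> ~ B a) \/ barred B [::] V].
Proof.
move=> Ub.
pose decides a V := barred B a V \/
  forall W, W `<=` V -> branching W -> ~ barred B a W.
(* First fusion: every finite chain of [T1] is either accepted by the part of [T1] above it or
   rejected by all branching subsets of that part. *)
have [||T1 [T1U _ T1b T1dec]] := @fusion decides U _ _ Ub.
- move=> a V W VW [Wbar|Wrej]; [left|right]; first exact: barred_sub Wbar.
  by move=> X XV; apply: Wrej; exact: subset_trans VW.
- move=> a V _ _ _ Vb; have [[W [WV Wb Wbar]]|no] :=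
      pselect (exists W, [/\ W `<=` V, branching W & barred B a W]).
    by exists W; split=> //; left.
  by exists V; split=> //; right => W WV Wb Wbar; apply: no; exists W.
pose acc a := barred B a (T1 `&` above a).
have [acc0|rej0] := pselect (acc [::]).
  exists T1; split=> //; right; apply: barred_sub acc0 => t T1t; split=> //.
(* Second fusion: rejection is to pass from a chain to all its extensions by one node above it. *)
pose rejects a V := ~ acc a -> forall t, V t -> ~ acc (t :: a).
have [||T2 [T2T1 _ T2b T2rej]] := @fusion rejects T1 _ _ T1b.
- by move=> a V W VW Wrej /Wrej h t /VW; exact: h.
- move=> a V ac aT1 VT1 Vb.
  have [acca|rej] := pselect (acc a); first by exists V; split.
  have [[u [Vu uP]]|no] := pselect (exists u, V u /\
      forall t, V t -> tlt u t -> ~ acc (t :: a)).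
    exists (V `&` above [:: u]); split; first by move=> ? [].
      exact: branching_cone.
    by move=> _ t [Vt /= /andP[ut _]]; exact: uP.
  (* Otherwise the nodes giving accepted extensions are cofinal in [V]. They form a branching set,
     which accepts [a] by [barred_cons], against the rejection of [a]. *)
  pose W := V `&` [set t | acc (t :: a)].
  have Wb : branching W.
    apply: branching_dense => // u Vu; apply: contrapT => nv; apply: no.
    exists u; split=> // t Vt ut acct; apply: nv; exists t; split=> //.
  have Wbar : barred B a W.
    apply: (@barred_cons _ _ T1); first by move=> t [/VT1 []].
      by move=> t [].
    by move=> t [/VT1 []].
  exfalso; have [//|no_acc] := T1dec a ac aT1.
  by apply: no_acc Wb Wbar => t [/VT1].
exists T2; split=> //; first exact: subset_trans T1U.
left=> a ac aT2 Ba.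
(* [B a] would make [a] accepted through the empty initial segment, while rejection spreads from the
   empty chain to all of [T2]. *)
suff : ~ acc a by apply=> c _ _; exists 0%N.
elim: a ac aT2 {Ba} => // t a IH /andP[ta ac] taT2.
have aT2 : [set` a] `<=` T2.
  by move=> x xa; apply: taT2; rewrite /= inE xa orbT.
apply: (T2rej a) => //; first exact: IH.
by split=> //; apply: taT2; rewrite /= mem_head.
Qed.

(** * Pieces of [F], compactness along a chain, and obstructions *)

Lemma partition_by_values (R : realType) (F : set (dyadic -> R)) (M theta : R)
    (a : seq dyadic) :
  0 < theta -> (forall f, F f -> forall s, `|f s| <= M) ->
  exists L : seq (set (dyadic -> R)),
    (forall K, K \in L -> K `<=` F /\
       forall f g, K f -> K g -> forall x, x \in a -> `|f x - g x| <= theta) /\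
    (forall f, F f -> exists K, K \in L /\ K f).
Proof.
move=> theta0 FM; elim: a => [|x a [L [LF Lcov]]].
  exists [:: F]; split=> [K|f Ff]; first by rewrite inE => /eqP ->; split.
  by exists F; rewrite mem_head.
(* The index of the interval of length [theta], counted from [- M], that contains [f x]; the bound
   [M] leaves finitely many indices. *)
pose level (f : dyadic -> R) := Num.truncn ((f x + M) / theta).
have level_itv f : F f -> (level f)%:R * theta <= f x + M < (level f).+1%:R * theta.
  move=> /FM /(_ x); rewrite ler_norml => /andP[fx _].
  rewrite -ler_pdivlMr // -ltr_pdivrMr // truncn_itv // divr_ge0 ?(ltW theta0) //.
  by rewrite -lerBlDr sub0r.
pose N := (Num.truncn ((M + M) / theta)).+1.
exists [seq K `&` [set f | level f = i] | K <- L, i <- iota 0 N]; split.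
  move=> _ /allpairsP[[K i] /= [KL _ ->]]; have [KF Ksmall] := LF K KL.
  split=> [f [/KF]//|f g [Kf fi] [Kg gi] y].
  rewrite inE => /predU1P[->|ya]; last exact: Ksmall.
  have := level_itv _ (KF _ Kf); have := level_itv _ (KF _ Kg).
  rewrite fi gi -natr1 mulrDl mul1r => /andP[g1 g2] /andP[f1 f2].
  by rewrite ler_norml; apply/andP; split; lra.
move=> f Ff; have [K [KL Kf]] := Lcov f Ff.
exists (K `&` [set g | level g = level f]); split; last by split.
apply/allpairsP; exists (K, level f); split=> //.
rewrite mem_iota add0n ltnS; apply: le_truncn.
rewrite ler_pM2r ?invr_gt0 // lerD2r.
by have := FM f Ff x; rewrite ler_norml => /andP[].
Qed.

Lemma bcn_compact_chain (R : realType) (F : set (dyadic -> R)) (theta : R)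
    (c : nat -> dyadic) (f_ : nat -> dyadic -> R) :
  F `<=` bcn R -> pointwise_compact F -> 0 < theta ->
  (forall i, tlt (c i) (c i.+1)) -> (forall k, F (f_ k)) ->
  ~ (forall k j, (j <= k)%N -> theta <= `|f_ k (c j)|).
Proof.
move=> F_bcn F_compact theta0 c_incr Ff f_big.
have [|f [Ff' fcl]] := F_compact (fmap (f_ : nat -> {ptws dyadic -> R}) \oo) _.
  by exists 0%N => // k _; exact: Ff.
(* The condition [|g (c j)| < theta] is open and fails for every [f_ k] with [j <= k], so it fails
   for the cluster point [f]. *)
have f_ge j : theta <= `|f (c j)|.
  rewrite leNgt; apply/negP => f_lt.
  pose V := [set g : {ptws dyadic -> R} | `|g (c j)| < theta].
  have Vf : nbhs f V.
    apply: (@proj_continuous dyadic (fun=> R : topologicalType) (c j) f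
      [set r | `|r| < theta]).
    exact: (norm_continuous (lt_nbhsl f_lt)).
  have [|g [[k jk <-]]] := fcl (f_ @` [set k | (j <= k)%N]) V _ Vf.
    by exists j => // k /= jk; exists k.
  by rewrite /V /= ltNge f_big.
have c_lt := increasing_tlt c_incr.
have c_inj : injective c.
  move=> i j cij; have [/c_lt|/c_lt|//] := ltngtP i j;
  by rewrite cij tlt_irr.
have c_chain : is_chain setT (range c).
  split=> // [|_ _ [i _ <-] [j _ <-]].
    apply/infiniteP; have := inj_card_eq (A := [set: nat]) (in2W c_inj).
    by rewrite card_eq_sym card_eq_le => /andP[].
  have [/c_lt/tltW|/c_lt/tltW|->] := ltngtP i j; [by left|by right|].
  by left; exact: tle_refl.
have [_ f_cvg] := F_bcn _ Ff'.
have c_enum : enumerates (range c) c by split.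
have /cvgr0_norm_lt/(_ _ theta0)[N _ /(_ N (leqnn N))] := f_cvg _ _ c_chain c_enum.
by rewrite /= ltNge f_ge.
Qed.

(** The existence clause excludes vacuous obstructions and supplies the functions to which
    compactness is applied. *)
Definition obstructs (R : realType) (delta theta : R) (K : set (dyadic -> R))
    (m : dyadic) (A : seq dyadic) : Prop :=
  (exists f, K f /\ forall x, x \in A -> delta <= f x) /\
  forall g, K g -> (forall x, x \in A -> delta <= g x) -> theta <= `|g m|.

Lemma no_obstructed_chain (R : realType) (F K : set (dyadic -> R))
    (delta theta : R) (c : nat -> dyadic) :
  F `<=` bcn R -> pointwise_compact F -> K `<=` F -> 0 < theta ->
  (forall i, tlt (c i) (c i.+1)) ->
  ~ (forall k j, (j <= k)%N -> exists n, obstructs delta theta K (c j)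
       (rev (mkseq (fun i => c (k.+1 + i)%N) n))).
Proof.
move=> F_bcn F_compact KF theta0 c_incr obs.
have /choice[f_ f_P] : forall k, exists f, K f /\
    forall j, (j <= k)%N -> theta <= `|f (c j)|.
  move=> k.
  have /choice[n nP] : forall j : 'I_k.+1, exists n, obstructs delta theta K (c j)
       (rev (mkseq (fun i => c (k.+1 + i)%N) n)).
    by move=> j; apply: obs; rewrite -ltnS.
  (* The segments are nested, so a function that is at least [delta] on the longest one serves for
     every [j <= k]. *)
  pose j0 := [arg max_(j > (ord0 : 'I_k.+1)) n j]%N.
  have n_max j : (n j <= n j0)%N.
    by rewrite /j0; case: arg_maxnP => // i _; apply.
  have [[f [Kf fP]] _] := nP j0; exists f; split=> // j jk.
  have [_] := nP (Ordinal (jk : (j < k.+1)%N)); apply=> // x.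
  rewrite mem_rev => /mapP[i]; rewrite mem_iota => /andP[_ i_lt] ->.
  apply: fP; rewrite mem_rev; apply/mapP; exists i => //.
  by rewrite mem_iota /= (leq_trans i_lt) // leq_add2l.
apply: (bcn_compact_chain (c := c) (f_ := f_) F_bcn F_compact theta0) => //.
  by move=> k; have [/KF] := f_P k.
by move=> k; have [_] := f_P k.
Qed.

Lemma subtree_without_obstructions (R : realType) (F : set (dyadic -> R))
    (delta : R) (theta : nat -> R)
    (pieces : seq dyadic -> seq (set (dyadic -> R))) :
  F `<=` bcn R -> pointwise_compact F -> (forall k, 0 < theta k) ->
  (forall a (K : set (dyadic -> R)), K \in pieces a -> K `<=` F) ->
  exists T, is_subtree T /\
    forall m a A (K : set (dyadic -> R)), finite_chain (m :: a) ->
      [set` m :: a] `<=` T ->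
      finite_chain A -> [set` A] `<=` T `&` above (m :: a) -> K \in pieces a ->
      ~ obstructs delta (theta (size a)) K m A.
Proof.
move=> F_bcn F_compact theta0 piecesF.
pose obs (a : seq dyadic) K m A := obstructs delta (theta (size a)) K m A.
pose free (a : seq dyadic) K m (V : set dyadic) :=
  forall A, finite_chain A -> [set` A] `<=` V -> ~ obs a K m A.
pose decides b V := if b is m :: a then
  forall K : set (dyadic -> R), K \in pieces a ->
    free a K m V \/ barred (obs a K m) [::] V else True.
(* First fusion: the dichotomy is settled for each node [m] over a chain [a] and each of the
   finitely many pieces of [a]. *)
have [||TA [_ _ TAb TAdec]] := @fusion decides setT _ _ branchingT.
- move=> [//|m a] V W VW decW K /decW [Wfree|Wbar]; [left|right].
    by move=> A Ac AV; apply: Wfree => //; exact: subset_trans VW.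
  exact: barred_sub Wbar.
- move=> [|m a] V _ _ _ Vb; first by exists V; split.
  pose Q K W := free a K m W \/ barred (obs a K m) [::] W.
  apply: (@shrink_all _ (pieces a) Q) => //.
    move=> K V' W VW [Wfree|Wbar]; [left|right].
      by move=> A Ac AV; apply: Wfree => //; exact: subset_trans VW.
    exact: barred_sub Wbar.
  by move=> K W _ _ Wb; exact: nash_williams_tree.
pose good a K m := free a K m (TA `&` above (m :: a)).
pose good_for a V := forall K : set (dyadic -> R), K \in pieces a ->
  forall m, V m -> good a K m.
(* Second fusion: above each chain only the nodes obstructed by no finite chain of [TA] are kept. *)
have [||T [TTA T_subtree _ Tgood]] := @fusion good_for TA _ _ TAb.
- by move=> a V W VW Wgood K Ka m /VW; exact: Wgood.
- move=> a V0 ac aTA V0TA V0b.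
  pose Q K W := forall m, W m -> good a K m.
  apply: (@shrink_all _ (pieces a) Q) => //; first by move=> K V W VW QW m /VW /QW.
  move=> K V Ka VV0 Vb.
  have [[u [Vu uP]]|no] := pselect (exists u, V u /\
      forall m, V m -> tlt u m -> good a K m).
    exists (V `&` above [:: u]); split; first by move=> ? [].
      exact: branching_cone.
    by move=> m [Vm /= /andP[um _]]; exact: uP.
  (* Otherwise bad nodes are cofinal in [V], and iterating [h] climbs through them; off [V] its
     value is a dummy. *)
  have /choice[h hP] : forall u, exists m, V u -> [/\ V m, tlt u m & ~ good a K m].
    move=> u; have [Vu|nVu] := pselect (V u); last by exists u.
    apply: contrapT => nm; apply: no; exists u; split=> // m Vm um.
    by apply: contrapT => mbad; apply: nm; exists m.
  have [[u0 Vu0] _] := Vb.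
  (* The sequence starts at [h u0], since [u0] itself may be good. *)
  pose c i := iter i.+1 h u0.
  have iterV i : V (iter i h u0) by elim: i => // i /hP[].
  have cP i : [/\ V (c i), tlt (c i) (c i.+1) & ~ good a K (c i)].
    by have [h1 _ h3] := hP _ (iterV i); have [_ h2 _] := hP _ h1; split.
  have c_incr i : tlt (c i) (c i.+1) by have [] := cP i.
  exfalso; apply: (@no_obstructed_chain _ F K delta (theta (size a)) c) => //.
    exact: piecesF Ka.
  move=> k j jk; have [Vc _ cbad] := cP j.
  have [TAc ca] := V0TA _ (VV0 _ Vc).
  have := TAdec (c j :: a); rewrite /decides.
  have cac : finite_chain (c j :: a) by apply/andP.
  have caT : [set` c j :: a] `<=` TA by move=> x /predU1P[->//|]; exact: aTA.
  (* As [c j] is bad, the bar alternative holds. It applies to the tail of [c] after index [k],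
     which lies above [c j] because [j <= k]. *)
  move=> /(_ cac caT K Ka)[/cbad//|].
  move=> /(_ (fun i => c (k.+1 + i)%N))[i|i|n].
  - by rewrite addnS.
  - have [Vi _ _] := cP (k.+1 + i)%N; have [TAi ai] := V0TA _ (VV0 _ Vi).
    split=> //; apply/andP; split=> //.
    by apply: (increasing_tlt c_incr); rewrite addSn ltnS (leq_trans jk) ?leq_addr.
  - by rewrite cats0; exists n.
exists T; split=> // m a A K mac maT Ac AT Ka.
have /andP[ma ac] := mac.
apply: (Tgood a ac _ K Ka m) => //.
- by move=> x xa; apply: maT; rewrite /= inE xa orbT.
- by split=> //; apply: maT; rewrite /= mem_head.
- by move=> x /AT[/TTA].
Qed.

(** * Killing the values outside [I] one position at a time *)

Lemma finite_chain_rev (s : nat -> dyadic) (l : seq nat) :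
  (forall i j, (i < j)%N -> tlt (s i) (s j)) -> sorted ltn l ->
  finite_chain (rev [seq s i | i <- l]).
Proof.
move=> s_lt l_sorted; rewrite /finite_chain -sorted_pairwise; last first.
  by move=> y x z xy yz; exact: tlt_trans xy.
by rewrite rev_sorted; apply: homo_sorted l_sorted => i j; exact: s_lt.
Qed.

Theorem theorem2p2 (R : realType) (F : set (dyadic -> R)) (delta eps : R)
    (F_bcn : F `<=` bcn R)
    (F_compact : pointwise_compact F)
    (F_bounded : sup_norm_bounded F)
    (delta_gt0 : 0 < delta)
    (eps_gt0 : 0 < eps)
    (eps_lt1 : eps < 1) :
  exists T : set dyadic, is_subtree T /\
    forall (beta : set dyadic) (s : nat -> dyadic),
      is_chain T beta -> enumerates beta s ->
    forall f : dyadic -> R, F f ->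
    forall (n : nat) (I : {set 'I_n}), I != finset.set0 ->
      (forall i : 'I_n, i \in I -> delta < f (s i)) ->
      exists g : dyadic -> R,
        [/\ F g,
            forall i : 'I_n, i \in I -> (1 - eps) * delta < g (s i) &
            \sum_(i < n | i \notin I) `|g (s i)| < eps * delta].
Proof.
have [M FM] := F_bounded.
(* Step [k] moves each of the [k] earlier values by at most [theta k] and leaves
   at most [theta k] at the killed node: a total cost of [tau k]. *)
pose tau k : R := eps * delta / 2 ^+ k.+1.
pose theta k : R := tau k / k.+1%:R.
have tau_gt0 k : 0 < tau k by rewrite !(mulr_gt0, invr_gt0, exprn_gt0).
have theta_gt0 k : 0 < theta k by rewrite divr_gt0.
have tauE k : tau k = theta k * k%:R + theta k.
  by rewrite -[X in _ + X]mulr1 -mulrDr natr1 divfK ?pnatr_eq0.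
(* A geometric sum, strictly below its limit; this gives both strict inequalities of the
   conclusion. *)
have sum_tau n : \sum_(0 <= k < n) tau k < eps * delta.
  have -> : \sum_(0 <= k < n) tau k = eps * delta * (1 - (2 ^+ n)^-1).
    elim: n => [|n IH]; first by rewrite big_nil expr0 invr1 subrr mulr0.
    rewrite big_nat_recr //= IH /tau exprS; field.
    by rewrite expf_neq0.
  by rewrite -subr_gt0 -[X in X - _]mulr1 -mulrBr subKr !mulr_gt0 ?invr_gt0 ?exprn_gt0.
have /choice[pieces piecesP] a :=
  partition_by_values a (theta_gt0 (size a)) FM.
have [|T [T_subtree T_free]] := @subtree_without_obstructions R F delta theta
    pieces F_bcn F_compact theta_gt0 _.
  by move=> a K Ka; have [/(_ K Ka)[]] := piecesP a.
exists T; split=> // beta s [beta_T _ _] [s_range s_lt] f Ff n I _ fI.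
have sT i : T (s i) by apply: beta_T; rewrite -s_range; exists i.
pose J (i : nat) := [exists k : 'I_n, (val k == i) && (k \in I)].
have JE (i : 'I_n) : J i = (i \in I).
  apply/existsP/idP => [[k /andP[/eqP ki kI]]|iI]; last by exists i; rewrite eqxx.
  by rewrite -(val_inj ki).
pose err (g : dyadic -> R) i := if J i then 0 else `|g (s i)|.
(* Invariant once the positions below [l] are treated: those in [I] have dropped below [delta] by at
   most the cost so far, while those ahead keep the full bound [delta], as the next use of
   non-obstruction requires. *)
suff /(_ n (leqnn n))[g [Fg _ gJ gerr]] : forall l, (l <= n)%N ->
    exists g, [/\ F g,
    forall i, (l <= i < n)%N -> J i -> delta <= g (s i),
    forall i, (i < l)%N -> J i -> delta - \sum_(0 <= k < l) tau k <= g (s i) &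
    \sum_(0 <= i < l) err g i <= \sum_(0 <= k < l) tau k].
  exists g; split=> // [i iI|].
    apply: lt_le_trans (gJ i (ltn_ord i) _); last by rewrite JE.
    by have := sum_tau n; lra.
  apply: le_lt_trans (sum_tau n); apply: le_trans gerr.
  rewrite big_mkord big_mkcond /=; apply: ler_sum => i _.
  by rewrite /err JE; case: (i \in I).
elim=> [_|l IH l_lt].
  exists f; split=> //; last by rewrite !big_nil.
  move=> i /= i_lt; rewrite (JE (Ordinal i_lt)) => /fI; exact: ltW.
have [g [Fg g_hi g_lo g_err]] := IH (ltnW l_lt).
have sum_err_ge i : (i < l)%N -> J i ->
    delta - \sum_(0 <= k < l.+1) tau k <= g (s i) - theta l.
  move=> il Ji; have := g_lo i il Ji; rewrite big_nat_recr //= tauE.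
  by have := mulr_ge0 (ltW (theta_gt0 l)) (ler0n R l); lra.
(* At a position of [I] nothing is killed and [g] is kept. *)
have [Jl|nJl] := boolP (J l).
  exists g; split=> // [i /andP[/ltnW li i_lt]|i|].
  - by apply: g_hi; rewrite li.
  - rewrite ltnS leq_eqVlt => /predU1P[->|il] Ji.
      apply: le_trans (g_hi l _ Ji); last by rewrite leqnn.
      by rewrite gerBl sumr_ge0 // => k _; exact: ltW.
    by have := sum_err_ge i il Ji; have := theta_gt0 l; lra.
  - rewrite !big_nat_recr //= {2}/err Jl addr0.
    by apply: le_trans g_err _; rewrite lerDl ltW.
pose a := rev (mkseq s l).
have aE : rev (mkseq s l.+1) = s l :: a by rewrite mkseqS rev_rcons.
have [K [Ka Kg]] : exists K, K \in pieces a /\ K g.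
  by have [_] := piecesP a; exact.
have [/(_ K Ka)[KF K_small] _] := piecesP a.
(* The nodes of [I] still ahead, where the bound [delta] must be preserved. *)
pose A := rev [seq s i | i <- iota l.+1 (n - l.+1) & J i].
have memA x : x \in A -> exists i, [/\ (l < i < n)%N, J i & x = s i].
  rewrite mem_rev => /mapP[i]; rewrite mem_filter mem_iota subnKC // => /andP[Ji il] ->.
  by exists i.
have A_above x : x \in A -> above (s l :: a) x.
  move=> /memA[i [/andP[li _] _ ->]]; rewrite -aE; apply/allP => y.
  rewrite mem_rev => /mapP[j]; rewrite mem_iota /= add0n ltnS => jl ->.
  by apply: s_lt; exact: leq_ltn_trans li.
have /not_andP[|] : ~ obstructs delta (theta (size a)) K (s l) A.
  apply: T_free => //.
  - by rewrite -aE; apply: finite_chain_rev => //; exact: iota_ltn_sorted.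
  - by rewrite -aE => x /=; rewrite mem_rev => /mapP[j _ ->].
  - apply: finite_chain_rev => //; apply: sorted_filter (iota_ltn_sorted _ _).
    exact: ltn_trans.
  - by move=> x xA; split; [have [i [_ _ ->]] := memA x xA|exact: A_above].
(* [g] itself satisfies the existence clause, so the other clause fails, and its counterexample is
   the next function [h]. *)
- case; exists g; split=> // x /memA[i [/andP[li i_lt] Ji ->]].
  by apply: g_hi => //; rewrite ltnW.
have size_a : size a = l by rewrite size_rev size_mkseq.
rewrite size_a => no_big.
have [h [Kh hA hl]] : exists h, [/\ K h, forall x, x \in A -> delta <= h x &
    `|h (s l)| < theta l].
  apply: contrapT => no; apply: no_big => h Kh hA.
  by rewrite leNgt; apply/negP => hl; apply: no; exists h.
have h_near i : (i < l)%N -> `|h (s i) - g (s i)| <= theta l.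
  move=> il; rewrite -size_a; apply: K_small => //.
  by rewrite mem_rev; apply: map_f; rewrite mem_iota.
exists h; split; first exact: KF.
- move=> i /andP[li i_lt] Ji; apply: hA; rewrite mem_rev; apply: map_f.
  by rewrite mem_filter Ji mem_iota subnKC // li.
- move=> i; rewrite ltnS leq_eqVlt => /predU1P[->|il] Ji.
    by rewrite Ji in nJl.
  apply: le_trans (sum_err_ge i il Ji) _.
  by have := h_near i il; rewrite ler_norml => /andP[+ _]; lra.
rewrite !big_nat_recr //= tauE addrA; apply: lerD; last first.
  by rewrite /err (negbTE nJl) ltW.
(* Each of the [l] earlier positions costs at most [theta l]; with the value left at position [l]
   this is [tau l], by [tauE]. *)
apply: le_trans (_ : \sum_(0 <= i < l) (err g i + theta l) <= _).
  rewrite big_nat [leRHS]big_nat; apply: ler_sum => i /= il.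
  rewrite /err; case: ifP => _; first by rewrite addr_ge0 // ltW.
  have -> : h (s i) = g (s i) + (h (s i) - g (s i)) by lra.
  by apply: le_trans (ler_normD _ _) _; rewrite lerD2l h_near.
by rewrite big_split /= sumr_const_nat subn0 mulr_natr lerD2r.
Qed.
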